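(* Let $\mathcal{P}$ be a radical parametrization in $n$ parameters over a radical tower $\mathbb{T}$ with $m$ radicals, given with a fixed representation as in the context. Then the tower variety $\mathcal{V}_\mathbb{T}\subset\mathbb{C}^{n+m}$ is irreducible and has dimension $n$. Furthermore, $\mathcal{V}_\mathbb{T}=\overline{\pi^*(\mathcal{B}_\mathcal{P})}$.
   Context: Let $\overline{t}=(t_1,\dots,t_n)$. A radical tower $\mathbb{T}$ over $\mathbb{C}(\overline{t})$ is a tower of fields $\mathbb{F}_0=\mathbb{C}(\overline{t})\subseteq\dots\subseteq\mathbb{F}_m$ with $\mathbb{F}_i=\mathbb{F}_{i-1}(\delta_i)$, $\delta_i^{e_i}=\alpha_i\in\mathbb{F}_{i-1}$, $e_i\in\mathbb{N}$. A radical parametrization $\mathcal{P}$ is a tuple $\overline{x}=(x_1,\dots,x_r)$ of elements of $\mathbb{F}_m$, $r>n$, whose Jacobian with respect to $\overline{t}$ (derivations extended to $\mathbb{F}_m$) has rank $n$; the $\delta_i$ are realized as analytic functions $\delta_i(\overline{t})$ by fixing branch values $\delta_i(\overline{t}_0)=a_i$ at some point. The representation consists of polynomials with $x_j=x_{jN}(\overline{t},\overline{\delta})/x_{jD}(\overline{t},\overline{\delta})$, $\overline{\delta}=(\delta_1,\dots,\delta_m)$ (and similarly each $\alpha_i$ written as a quotient of polynomials in $\overline{t},\delta_1,\dots,\delta_{i-1}$). Let $\varphi:\mathbb{C}^n\to\mathbb{C}^{n+m+r}$, $\overline{t}\mapsto(\overline{t},\overline{\delta}(\overline{t}),\overline{x}(\overline{t}))$,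 and $\mathcal{B}_\mathcal{P}=\overline{\mathrm{Im}(\varphi)}$ (Zariski closure), the incidence variety. Let $\psi:\mathbb{C}^n\to\mathbb{C}^{n+m}$, $\overline{t}\mapsto(\overline{t},\overline{\delta}(\overline{t}))$; the tower variety is $\mathcal{V}_\mathbb{T}=\overline{\mathrm{Im}(\psi)}$. The map $\pi^*:\mathcal{B}_\mathcal{P}\to\mathbb{C}^{n+m}$ is the projection $(\overline{t},\overline{\delta},\overline{x})\mapsto(\overline{t},\overline{\delta})$. *)

(* Defs.v *)
From HB Require Import structures.
From mathcomp Require Import all_boot all_order all_algebra.
From mathcomp.real_closed Require Import complex.
From mathcomp Require Import all_classical all_reals all_analysis.
From mathcomp Require mpoly.
Import Order.TTheory GRing.Theory Num.Theory.
Import numFieldNormedType.Exports.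

Set Implicit Arguments.
Unset Strict Implicit.
Unset Printing Implicit Defensive.

Local Open Scope ring_scope.
Local Open Scope classical_set_scope.

(* The complex numbers: R[i] for a real field R : realType, seen through the
   regular-algebra alias ^o so that it carries its standard (modulus) topology
   and normed structure from mathcomp-analysis. *)
Notation cplx R := ((R[i])^o).

Section Zariski.
Variables (K : fieldType) (N : nat).

Definition zeros (F : set (mpoly.mpoly N K)) : set ('I_N -> K) :=
  [set x | forall p, F p -> mpoly.meval x p = 0].

Definition vanishing (S : set ('I_N -> K)) : set (mpoly.mpoly N K) :=
  [set p | forall x, S x -> mpoly.meval x p = 0].

Definition zariski_closure (S : set ('I_N -> K)) : set ('I_N -> K) :=
  zeros (vanishing S).

Definition zariski_closed (V : set ('I_N -> K)) : Prop :=
  exists F, V = zeros F.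

Definition zirreducible (V : set ('I_N -> K)) : Prop :=
  V !=set0 /\
  forall A B, zariski_closed A -> zariski_closed B ->
    V `<=` A `|` B -> V `<=` A \/ V `<=` B.

Definition zchain (V : set ('I_N -> K)) (k : nat)
    (Z : nat -> set ('I_N -> K)) : Prop :=
  (forall i, (i <= k)%N ->
     [/\ zariski_closed (Z i), zirreducible (Z i) & Z i `<=` V]) /\
  (forall i, (i < k)%N -> Z i `<` Z i.+1).

Definition zdim_eq (V : set ('I_N -> K)) (d : nat) : Prop :=
  (exists Z, zchain V d Z) /\ (forall Z, ~ zchain V d.+1 Z).

End Zariski.

Section Radical.
Variables (R : realType) (n m r : nat).
Local Notation C := (cplx R).

Definition tower_pt (delta : 'I_m -> 'rV[C]_n -> C) (t : 'rV[C]_n)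
    : 'I_(n + m) -> C :=
  fun k => match fintype.split k with
           | inl a => t ord0 a
           | inr j => delta j t
           end.

(* (t, delta_1(t), ..., delta_i(t)) for i < m (delta indices 0-based:
   this is the point at which alpha_{i} is evaluated, i.e. it uses the
   radicals strictly before the i-th one) *)
Definition tower_pt_lt (delta : 'I_m -> 'rV[C]_n -> C) (i : 'I_m)
    (t : 'rV[C]_n) : 'I_(n + i) -> C :=
  fun k => match fintype.split k with
           | inl a => t ord0 a
           | inr j => delta (widen_ord (ltnW (ltn_ord i)) j) t
           end.

Definition param_fun (delta : 'I_m -> 'rV[C]_n -> C)
    (xN xD : 'I_r -> mpoly.mpoly (n + m) C) (j : 'I_r) (t : 'rV[C]_n) : C :=
  mpoly.meval (tower_pt delta t) (xN j) / mpoly.meval (tower_pt delta t) (xD j).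

Definition incidence_pt (delta : 'I_m -> 'rV[C]_n -> C)
    (xN xD : 'I_r -> mpoly.mpoly (n + m) C) (t : 'rV[C]_n)
    : 'I_(n + m + r) -> C :=
  fun k => match fintype.split k with
           | inl a => tower_pt delta t a
           | inr j => param_fun delta xN xD j t
           end.

Definition proj_star (p : 'I_(n + m + r) -> C) : 'I_(n + m) -> C :=
  fun k => p (lshift r k).

Definition param_jacobian (delta : 'I_m -> 'rV[C]_n -> C)
    (xN xD : 'I_r -> mpoly.mpoly (n + m) C) (t : 'rV[C]_n) : 'M[C]_(r, n) :=
  \matrix_(j < r, k < n) derive (param_fun delta xN xD j) t (delta_mx 0 k).

Definition tower_variety (U : set 'rV[C]_n) (delta : 'I_m -> 'rV[C]_n -> C)
    : set ('I_(n + m) -> C) :=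
  zariski_closure (tower_pt delta @` U).

Definition incidence_variety (U : set 'rV[C]_n)
    (delta : 'I_m -> 'rV[C]_n -> C)
    (xN xD : 'I_r -> mpoly.mpoly (n + m) C) : set ('I_(n + m + r) -> C) :=
  zariski_closure (incidence_pt delta xN xD @` U).

End Radical.

Arguments tower_pt_lt {R n m} delta i t _.

(* Main.v *)
(* The identity theorem needed here is elementary, because every function
   f(t) = p(t, delta(t)) is algebraic over C[t].

   Counting: on the tower, polynomials of degree <= D in (t, delta) span a space
   of functions of dimension O(D^n), since delta_i^e_i = aN_i / aD_i allows one
   to reduce the powers of delta_i at the cost of a nowhere vanishing
   denominator.  There are D^(n+1) monomials in n+1 given functions, so any n+1
   functions are algebraically dependent.

   Irreducibility: on a complex line (n = 1), a relation
   sum_(k <= j < D) q_j(z) f^j = 0 with q_k <> 0 shows that, away from the roots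
   of q_k, a zero of f has a neighbourhood on which f vanishes.  Two points
   of a convex open set can be joined, after moving one of them slightly, by a
   segment avoiding the roots of q_k; hence f is 0 or vanishes only at roots of
   q_k.  Along lines this gives the identity theorem, so f g = 0 on the connected
   set U forces f = 0 or g = 0.

   Dimension: in a strict chain of irreducible closed sets Z_0 < ... < Z_k, a
   polynomial vanishing on Z_i but not on Z_(i+1) is algebraically independent
   on Z_(i+1) of any family independent on Z_i, so Z_k carries k independent
   functions and k <= n by counting.  Conversely the closures of the images of
   the slices t_j = c_j (j >= k) of a ball around c form a chain of length n. *)
Require Import Defs.
From HB Require Import structures.
From mathcomp Require Import all_boot all_order all_algebra.
From mathcomp.real_closed Require Import complex.
From mathcomp Require Import all_classical all_reals all_analysis.
From mathcomp Require mpoly.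
From mathcomp Require Import ring.
Import (canonicals) mpoly.
Import Order.TTheory GRing.Theory Num.Theory.
Import numFieldNormedType.Exports.
Local Open Scope ring_scope.
Local Open Scope classical_set_scope.

Set Implicit Arguments.
Unset Strict Implicit.
Unset Printing Implicit Defensive.

(** * Dimension growth *)

Lemma leq_expnW m m' k : (m <= m')%N -> (m ^ k <= m' ^ k)%N.
Proof. by case: k => // k mm'; rewrite leq_exp2r. Qed.

Section Growth.
Variables (K : fieldType) (T : Type).
Implicit Types (G : set (T -> K)) (f g h : T -> K).

(** Polynomial expressions of degree at most [D] in members of [G]. Working with functions instead
    of formal polynomials makes every relation between the generators hold automatically. *)
Inductive fdeg G : nat -> (T -> K) -> Prop :=
| fdeg_cst c : fdeg G 0 (cst c)
| fdeg_gen D g f : G g -> fdeg G D f -> fdeg G D.+1 (g * f)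
| fdeg_add D f h : fdeg G D f -> fdeg G D h -> fdeg G D (f + h)
| fdeg_S D f : fdeg G D f -> fdeg G D.+1 f.

Lemma fdeg_le G D D' f : (D <= D')%N -> fdeg G D f -> fdeg G D' f.
Proof.
move=> /subnK <-; elim: (D' - D)%N => [//|k IH] /IH.
by rewrite addSn; apply: fdeg_S.
Qed.

Lemma fdeg_mono G G' D f : G `<=` G' -> fdeg G D f -> fdeg G' D f.
Proof.
move=> GG'; elim=> {D f} [c|D g f /GG' Gg _|D f h _ fD _|D f _].
- exact: fdeg_cst.
- exact: fdeg_gen.
- exact: fdeg_add.
- exact: fdeg_S.
Qed.

Lemma fdeg_scale G D c f : fdeg G D f -> fdeg G D (cst c * f).
Proof.
elim=> {D f} [c'|D g f Gg _ IH|D f h _ fD _ hD|D f _].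
- have -> : cst c * cst c' = cst (c * c') :> (T -> K) by apply/funext.
  exact: fdeg_cst.
- by rewrite mulrCA; apply: fdeg_gen.
- by rewrite mulrDr; apply: fdeg_add.
- exact: fdeg_S.
Qed.

Lemma fdeg_mul G D D' f h : fdeg G D f -> fdeg G D' h -> fdeg G (D + D') (f * h).
Proof.
move=> + hD; elim=> {D f} [c|D g f Gg _ IH|D f h' _ fD _ h'D|D f _].
- exact: fdeg_scale.
- by rewrite -mulrA addSn; apply: fdeg_gen.
- by rewrite mulrDl; apply: fdeg_add.
- by rewrite addSn; apply: fdeg_S.
Qed.

Lemma fdeg1 G g : G g -> fdeg G 1 g.
Proof. by move=> Gg; rewrite -(mulr1 g); apply: fdeg_gen => //; apply: fdeg_cst. Qed.

Lemma fdeg_exp G D f k : fdeg G D f -> fdeg G (k * D) (f ^+ k).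
Proof.
move=> fD; elim: k => [|k IH]; first exact: fdeg_cst.
by rewrite exprS mulSn; apply: fdeg_mul.
Qed.

Definition alg_gen G f := exists D, fdeg G D f.

Lemma alg_gen_mono G G' f : G `<=` G' -> alg_gen G f -> alg_gen G' f.
Proof. by move=> GG' [D fD]; exists D; apply: fdeg_mono fD. Qed.

Lemma alg_gen_cst G c : alg_gen G (cst c).
Proof. by exists 0%N; apply: fdeg_cst. Qed.

Lemma alg_gen1 G g : G g -> alg_gen G g.
Proof. by move=> Gg; exists 1%N; apply: fdeg1. Qed.

Lemma alg_genD G f h : alg_gen G f -> alg_gen G h -> alg_gen G (f + h).
Proof.
move=> [D fD] [D' hD]; exists (maxn D D'); apply: fdeg_add.
  by apply: fdeg_le fD; rewrite leq_maxl.
by apply: fdeg_le hD; rewrite leq_maxr.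
Qed.

Lemma alg_genM G f h : alg_gen G f -> alg_gen G h -> alg_gen G (f * h).
Proof. by move=> [D fD] [D' hD]; exists (D + D')%N; apply: fdeg_mul. Qed.

Lemma alg_genX G f k : alg_gen G f -> alg_gen G (f ^+ k).
Proof. by move=> [D fD]; exists (k * D)%N; apply: fdeg_exp. Qed.

Lemma alg_gen_sum G (I : Type) (s : seq I) (F : I -> T -> K) :
  (forall i, alg_gen G (F i)) -> alg_gen G (\sum_(i <- s) F i).
Proof. by move=> GF; apply: big_ind => // *; [apply: alg_gen_cst | apply: alg_genD]. Qed.

Lemma alg_gen_meval G N (v : 'I_N -> T -> K) (p : mpoly.mpoly N K) :
  (forall k, alg_gen G (v k)) -> alg_gen G (fun t => mpoly.meval (v^~ t) p).
Proof.
move=> Gv.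
have -> : (fun t => mpoly.meval (v^~ t) p) = \sum_(mm <- mpoly.msupp p)
    cst (mpoly.mcoeff mm p) * \prod_(i < N) v i ^+ mpoly.fun_of_multinom mm i.
  apply/funext => t; rewrite mpoly.mevalE fct_sumE; apply: eq_bigr => mm _.
  rewrite mulrfctE fct_prodE; congr (_ * _).
  by apply: eq_bigr => i _; rewrite exprfctE.
apply: alg_gen_sum => mm; apply: alg_genM; first exact: alg_gen_cst.
by apply: big_ind => // *; [apply: alg_gen_cst|apply: alg_genM|apply: alg_genX].
Qed.

(** An O(D^n) bound on the Hilbert function of the algebra generated by [G]. The spanning functions
    [b] may lie outside that algebra, which leaves room for denominators. *)
Definition growth G n := exists A, forall D, exists (I : finType) (b : I -> T -> K),
  (#|I| <= A * D.+1 ^ n)%N /\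
  forall f, fdeg G D f -> exists c : I -> K, forall t, f t = \sum_i c i * b i t.

Lemma growth0 : growth set0 0.
Proof.
exists 1%N => D; exists unit, (fun _ => cst 1); split; first by rewrite card_unit expn0.
move=> f fD; suff [c ->] : exists c, f = cst c.
  by exists (fun _ => c) => t; rewrite big_const card_unit /= mulr1 addr0.
elim: fD => {D f} [c|D g f []|D f h _ [c ->] _ [c' ->]|//]; first by exists c.
by exists (c + c').
Qed.

(** The products of the [w D s] with a family spanning degree [L * D] over [G] span degree [D] over
    [G']; the bound on [W] counts them. *)
Lemma growth_step G G' n n' L B (W : nat -> nat) (w : nat -> nat -> T -> K) :
  growth G n ->
  (forall D, (W D * (L * D).+1 ^ n <= B * D.+1 ^ n')%N) ->
  (forall D f, fdeg G' D f -> exists q : nat -> T -> K,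
     (forall s, fdeg G (L * D) (q s)) /\
     forall t, f t = \sum_(s < W D) q s t * w D s t) ->
  growth G' n'.
Proof.
move=> [A GA] WB dec; exists (A * B)%N => D.
have [I [b [cardI spanb]]] := GA (L * D)%N.
exists ('I_(W D) * I)%type, (fun (si : 'I_(W D) * I) t => b si.2 t * w D si.1 t); split.
  rewrite card_prod card_ord -mulnA; apply: leq_trans (leq_mul (leqnn A) (WB D)).
  by rewrite mulnCA leq_mul2l cardI orbT.
move=> f /dec [q [qG fE]].
have /choice[c cE] : forall s, exists c : I -> K, forall t, q s t = \sum_i c i * b i t.
  by move=> s; apply: spanb.
exists (fun si : 'I_(W D) * I => c si.1 si.2) => t.
rewrite fE -(pair_bigA _ (fun (s : 'I_(W D)) i => c s i * (b i t * w D s t)))/=.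
by apply: eq_bigr => s _; rewrite cE mulr_suml; apply: eq_bigr => i _; rewrite mulrA.
Qed.

(** Expand in powers of [g]: in degree [D] there are [D.+1] of them, with coefficients of degree at
    most [D] over [G]. *)
Lemma growth_free G n g : growth G n -> growth (g |` G) n.+1.
Proof.
move=> Gn; apply: (@growth_step G _ n _ 1 1 succn (fun _ s t => g t ^+ s)) => //.
  by move=> D; rewrite !mul1n expnS.
move=> D f; elim=> {D f} [c|D g' f Gg' _ [q [qG qE]]
  |D f h _ [q [qG qE]] _ [q' [qG' qE']]|D f _ [q [qG qE]]].
- exists (fun _ => cst c); split; first by move=> s; apply: fdeg_cst.
  by move=> t; rewrite big_ord1 expr0 mulr1.
- case: Gg' => [->|Gg'].
    exists (fun s => if s is s'.+1 then q s' else cst 0); split.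
      case=> [|s]; first by apply: fdeg_le (fdeg_cst _ _).
      by apply: fdeg_le (qG s); rewrite !mul1n.
    move=> t; rewrite big_ord_recl/= mul0r add0r !mulrfctE qE mulr_sumr.
    by apply: eq_bigr => s _; rewrite /bump/= add1n exprS mulrCA.
  exists (fun s => if (s <= D)%N then g' * q s else cst 0); split.
    move=> s; case: ifP => _; last exact: fdeg_le (fdeg_cst _ _).
    by rewrite mul1n; apply: fdeg_gen => //; rewrite -(mul1n D).
  move=> t; rewrite big_ord_recr/= ltnn mul0r addr0 !mulrfctE qE mulr_sumr.
  by apply: eq_bigr => s _; rewrite -ltnS ltn_ord mulrA.
- exists (fun s => q s + q' s); split; first by move=> s; apply: fdeg_add.
  move=> t; rewrite addrfctE qE qE' -big_split/=.
  by apply: eq_bigr => s _; rewrite mulrDl.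
- exists (fun s => if (s <= D)%N then q s else cst 0); split.
    move=> s; case: ifP => _; last exact: fdeg_le (fdeg_cst _ _).
    by apply: fdeg_le (qG s); rewrite !mul1n.
  move=> t; rewrite big_ord_recr/= ltnn mul0r addr0 qE.
  by apply: eq_bigr => s _; rewrite -ltnS ltn_ord.
Qed.

(** Powers of [g] reduce below [e] at the cost of the denominator [aD ^+ D], so the number of powers
    does not depend on [D] and the exponent [n] is kept. *)
Lemma growth_alg G n g e aN aD : growth G n -> (0 < e)%N ->
  alg_gen G aN -> alg_gen G aD -> (forall t, aD t != 0) ->
  (forall t, g t ^+ e = aN t / aD t) ->
  growth (g |` G) n.
Proof.
move=> Gn; case: e => [//|e] _ [d1 aNG] [d2 aDG] aD0 gE.
(* One more generator multiplies a coefficient by [aN], by [aD], or by [aD] and a member of [G];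
   each of these has degree at most [L]. *)
set L := (maxn d1 d2).+1.
have {}aNG : fdeg G L aN by apply: fdeg_S; apply: fdeg_le aNG; apply: leq_maxl.
have {}aDG : fdeg G (maxn d1 d2) aD by apply: fdeg_le aDG; apply: leq_maxr.
apply: (@growth_step G _ n _ L (e.+1 * L ^ n) (fun=> e.+1)
  (fun D s t => g t ^+ s / aD t ^+ D)) => //.
  move=> D; rewrite -mulnA -expnMn leq_mul2l; apply: leq_expnW.
  by rewrite ltn_mul2l ltnSn.
move=> D f; elim=> {D f} [c|D g' f Gg' _ [q [qG qE]]
  |D f h _ [q [qG qE]] _ [q' [qG' qE']]|D f _ [q [qG qE]]].
- exists (fun s => if s == 0%N then cst c else cst 0); split.
    by move=> s; case: ifP => _; apply: fdeg_le (fdeg_cst _ _).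
  move=> t; rewrite big_ord_recl big1 => [|i _]; last by rewrite mul0r.
  by rewrite /= expr0 invr1 !mulr1 addr0.
- rewrite mulnS; case: Gg' => [->|Gg'].
    (* Multiplying by [g] shifts the powers; the top one wraps around through [g ^+ e.+1 = aN / aD],
       and all terms are brought over [aD ^+ D.+1]. *)
    exists (fun s => if s is s'.+1 then aD * q s' else aN * q e); split.
      by case=> [|s]; apply: fdeg_mul => //; apply: fdeg_S.
    move=> t; rewrite !mulrfctE big_ord_recl/= qE mulr_sumr big_ord_recr/= addrC; congr (_ + _).
      have -> : aN t = g t * g t ^+ e * aD t by rewrite -exprS gE divfK.
      by rewrite expr0 exprS; have a0 := aD0 t; field; rewrite expf_neq0// a0.
    apply: eq_bigr => s _; rewrite /bump/= add1n mulrfctE !exprS.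
    by have a0 := aD0 t; field; rewrite expf_neq0// a0.
  exists (fun s => g' * aD * q s); split.
    by move=> s; apply: fdeg_mul => //; apply: fdeg_gen.
  move=> t; rewrite !mulrfctE qE mulr_sumr; apply: eq_bigr => s _; rewrite !mulrfctE exprS.
  by have a0 := aD0 t; field; rewrite expf_neq0// a0.
- exists (fun s => q s + q' s); split; first by move=> s; apply: fdeg_add.
  move=> t; rewrite addrfctE qE qE' -big_split/=.
  by apply: eq_bigr => s _; rewrite mulrDl.
- rewrite mulnS; exists (fun s => aD * q s); split.
    by move=> s; apply: fdeg_mul => //; apply: fdeg_S.
  move=> t; rewrite qE; apply: eq_bigr => s _; rewrite mulrfctE exprS.
  by have a0 := aD0 t; field; rewrite expf_neq0// a0.
Qed.
End Growth.

(* Exponent vectors with entries below [D], last variable first, so that sums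
   over them split along the powers of the last variable. *)
Fixpoint expo (D n : nat) : finType :=
  if n is n'.+1 then ('I_D * expo D n')%type else unit.

Fixpoint mon (A : comPzRingType) (D n : nat) (F : nat -> A) : expo D n -> A :=
  match n with
  | 0 => fun=> 1
  | n'.+1 => fun al => F n' ^+ al.1 * mon F al.2
  end.

Lemma card_expo D n : #|expo D n| = (D ^ n)%N.
Proof. by elim: n => [|n IH]; rewrite ?card_unit// card_prod card_ord IH expnS. Qed.

Lemma rmorph_mon (A B : comPzRingType) (phi : {rmorphism A -> B}) D n F (al : expo D n) :
  phi (mon F al) = mon (phi \o F) al.
Proof. by elim: n al => [|n IH] al /=; rewrite ?rmorph1// rmorphM rmorphXn IH. Qed.

Lemma eq_mon (A : comPzRingType) D n (F F' : nat -> A) (al : expo D n) :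
  (forall i, (i < n)%N -> F i = F' i) -> mon F al = mon F' al.
Proof.
elim: n al => [//|n IH] al FF' /=; rewrite FF'// IH// => i ilt.
by rewrite FF'// ltnW.
Qed.

Lemma sum_expoS (A : comPzRingType) D n (c : expo D n.+1 -> A) F :
  \sum_al c al * mon F al =
  \sum_(j < D) F n ^+ j * \sum_(al : expo D n) c (j, al) * mon F al.
Proof.
under [RHS]eq_bigr do rewrite mulr_sumr.
rewrite (pair_bigA _ (fun (j : 'I_D) al => F n ^+ j * (c (j, al) * mon F al)))/=.
by apply: eq_bigr => -[j al] _ /=; rewrite mulrCA.
Qed.

(** * Algebraic dependence by counting monomials *)

Section Dependence.
Variables (K : fieldType) (T : Type).

Lemma mon_fct D n (F : nat -> T -> K) (al : expo D n) t :
  mon F al t = mon (F ^~ t) al.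
Proof. by elim: n al => [|n IH] al //=; rewrite mulrfctE exprfctE IH. Qed.

Lemma fdeg_mon G d D n (F : nat -> T -> K) (al : expo D n) :
  (forall i, (i < n)%N -> fdeg G d (F i)) -> fdeg G (n * (D * d)) (mon F al).
Proof.
elim: n al => [|n IH] al FG /=; first exact: fdeg_cst.
rewrite mulSn; apply: fdeg_mul; last by apply: IH => i ilt; apply: FG; rewrite ltnW.
have := @fdeg_exp _ _ G d (F n) al.1 (FG _ (ltnSn n)); apply: fdeg_le.
by rewrite leq_mul2r (ltnW (ltn_ord _)) orbT.
Qed.

(** The coordinates of the [phi x] in the family [b] form a matrix with more rows than columns; a
    nonzero vector of its left kernel is the relation. *)
Lemma lin_dep (E I : finType) (b : I -> T -> K) (phi : E -> T -> K) :
  (#|I| < #|E|)%N ->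
  (forall x, exists c : I -> K, forall t, phi x t = \sum_i c i * b i t) ->
  exists c : E -> K, (exists x, c x != 0) /\ forall t, \sum_x c x * phi x t = 0.
Proof.
move=> IE /choice[M ME].
pose Mx := \matrix_(x < #|E|, i < #|I|) M (enum_val x) (enum_val i).
have kn0 : kermx Mx != 0.
  by rewrite kermx_eq0 /row_free neq_ltn (leq_ltn_trans (rank_leq_col Mx) IE).
pose v := nz_row (kermx Mx).
have v0 : v != 0 by rewrite nz_row_eq0.
have vM : v *m Mx = 0 by apply: sub_kermxP; apply: nz_row_sub.
exists (fun x => v 0 (enum_rank x)); split.
  by have /rV0Pn[x vx] := v0; exists (enum_val x); rewrite enum_valK.
move=> t; under eq_bigr do rewrite ME mulr_sumr.
rewrite exchange_big big1//= => i _.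
under eq_bigr do rewrite mulrA.
rewrite -mulr_suml (_ : \sum_x _ = (v *m Mx) 0 (enum_rank i)); first by rewrite vM mxE mul0r.
rewrite mxE (reindex (fun i : 'I_#|E| => enum_val i))/=; last exact: onW_bij (enum_val_bij _).
by apply: eq_bigr => x _; rewrite mxE enum_valK enum_rankK.
Qed.

Lemma growth_dep G n (F : nat -> T -> K) :
  growth G n -> (forall i, (i <= n)%N -> alg_gen G (F i)) ->
  exists D (c : expo D n.+1 -> K), (exists al, c al != 0) /\
    forall t, \sum_al c al * mon (F ^~ t) al = 0.
Proof.
move=> [A GA] FG.
have [d Fd] : exists d, forall i, (i <= n)%N -> fdeg G d (F i).
  have /choice[d Fd] : forall i, exists d, (i <= n)%N -> fdeg G d (F i).
    move=> i; case: (leqP i n) => [/FG[d ?]|_]; last by exists 0%N.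
    by exists d.
  exists (\max_(i < n.+1) d i) => i ilen; apply: fdeg_le (Fd i ilen).
  exact: (leq_bigmax (Ordinal (ilen : i < n.+1)%N)).
(* Monomials with exponents below D in n+1 functions of degree at most d have degree at most (n+1)Dd
   < LD. They lie in a span of size at most A L^n D^n, and D > A L^n makes this less than
   D^(n+1). *)
pose L := (n.+1 * d).+1; pose D := (A * L ^ n).+1.
have [I [b [cardI spanb]]] := GA (n.+1 * (D * d))%N.
have LD : ((n.+1 * (D * d)).+1 <= L * D)%N.
  by rewrite /L (mulnC D) mulnA -add1n [X in (_ <= X)%N]mulSn leq_add2r.
have cardIE : (#|I| < #|expo D n.+1|)%N.
  rewrite card_expo (leq_ltn_trans cardI)//.
  apply: (@leq_ltn_trans (A * (L * D) ^ n)).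
    by rewrite leq_mul2l leq_expnW ?orbT.
  by rewrite expnMn mulnA expnS ltn_pmul2r// expn_gt0.
have [c [c0 cE]] := lin_dep (phi := mon F) cardIE (fun al => spanb _ (fdeg_mon al Fd)).
exists D, c; split=> // t; rewrite -[RHS](cE t).
by apply: eq_bigr => al _; rewrite mon_fct.
Qed.

(* The case n = 1: grouping the relation by powers of [f], the lowest
   coefficient is a nonzero polynomial in [z]. *)
Lemma growth1_dep G (z f : T -> K) :
  growth G 1 -> alg_gen G z -> alg_gen G f ->
  exists D k (q : nat -> {poly K}), [/\ q k != 0, (k < D)%N &
    forall t, \sum_(k <= j < D) (q j).[z t] * f t ^+ j = 0].
Proof.
move=> G1 zG fG.
have [|D [c [[[j0 [i0 []]] c0] cE]]] := @growth_dep G 1 (fun i => if i == 0%N then z else f) G1.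
  by move=> i; case: ifP.
pose q j := if insub j is Some j' then \sum_(i < D) c (j', (i, tt)) *: 'X^i else 0.
have qj0 : q j0 != 0.
  rewrite /q valK; apply: contraNneq c0 => /polyP/(_ i0).
  rewrite coef0 coef_sum (bigD1 i0)//= big1 => [|i ii0].
    by rewrite coefZ coefXn eqxx mulr1 addr0 => ->.
  by rewrite coefZ coefXn eq_sym (negbTE (ii0 : (i : nat) != i0)) mulr0.
have exq : exists j, q j != 0 by exists j0.
case: (ex_minnP exq) => k qk kmin.
have kD : (k < D)%N := leq_ltn_trans (kmin _ qj0) (ltn_ord j0).
exists D, k, q; split=> // t.
rewrite -[RHS](cE t) sum_expoS.
transitivity (\sum_(j < D) (q j).[z t] * f t ^+ j).
  rewrite -(big_mkord xpredT (fun j => (q j).[z t] * f t ^+ j)).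
  rewrite [RHS](@big_cat_nat _ _ _ k 0 D)//=; last exact: ltnW.
  rewrite [X in _ = X + _]big1_seq ?add0r// => j.
  rewrite mem_index_iota => /= jk; have [->|/kmin] := eqVneq (q j) 0.
    by rewrite horner0 mul0r.
  by rewrite leqNgt jk.
apply: eq_bigr => j _; rewrite mulrC; congr (_ * _).
rewrite /q valK horner_sum sum_expoS; apply: eq_bigr => i _.
by rewrite (big_pred1 tt)/= => [|[]//]; rewrite mulr1 mulrC !hornerE.
Qed.
End Dependence.

(** * Zariski closed sets and chains *)

Section ZariskiTheory.
Variables (K : fieldType) (N : nat).
Implicit Types (S V W Z : set ('I_N -> K)) (p q f : mpoly.mpoly N K).

Lemma sub_zclosure S : S `<=` zariski_closure S.
Proof. by move=> x Sx p /(_ x Sx). Qed.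

Lemma zclosed_closure S : zariski_closed (zariski_closure S).
Proof. by exists (vanishing S). Qed.

Lemma zclosure_min S V : zariski_closed V -> S `<=` V -> zariski_closure S `<=` V.
Proof. by move=> [F ->] SF x Sx p Fp; apply: Sx => y /SF; apply. Qed.

Lemma zclosure_sub S V : S `<=` V -> zariski_closure S `<=` zariski_closure V.
Proof.
move=> SV; apply: zclosure_min; first exact: zclosed_closure.
exact: subset_trans SV (@sub_zclosure _).
Qed.

(** The primality condition on the ideal of [S]. Since [S] need not be closed, it can be checked on
    parametrized points. *)
Definition zdomain S := forall p q,
  (forall x, S x -> mpoly.meval x p * mpoly.meval x q = 0) ->
  (forall x, S x -> mpoly.meval x p = 0) \/ (forall x, S x -> mpoly.meval x q = 0).

Lemma zirreducible_domain V : zirreducible V -> zdomain V.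
Proof.
move=> [_ Virr] p q pq.
have zclosed1 (p' : mpoly.mpoly N K) : zariski_closed (zeros [set p']) by exists [set p'].
have [x Vx|Vp|Vq] := Virr _ _ (zclosed1 p) (zclosed1 q).
- by have /eqP := pq x Vx; rewrite mulf_eq0 => /orP[]/eqP px; [left|right] => _ ->.
- by left=> x /Vp; apply.
- by right=> x /Vq; apply.
Qed.

(** Points of [S] outside [A] and outside [B] give an equation p of [A] and an equation q of [B],
    neither vanishing on all of [S], although pq does. *)
Lemma zirreducible_closure S : S !=set0 -> zdomain S -> zirreducible (zariski_closure S).
Proof.
move=> [x0 Sx0] Sdom; split; first by exists x0; apply: sub_zclosure.
move=> A B Acl Bcl SAB.
suff [SA|SB] : S `<=` A \/ S `<=` B.
- by left; apply: zclosure_min.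
- by right; apply: zclosure_min.
apply: contrapT => /not_orP[/existsNP[x /not_implyP[Sx Ax]] /existsNP[y /not_implyP[Sy By]]].
case: Acl Bcl SAB Ax By => [FA ->] [FB ->] SAB.
move=> /existsNP[p /not_implyP[FAp px]] /existsNP[q /not_implyP[FBq qy]].
have [z Sz|/(_ x Sx)//|/(_ y Sy)//] := Sdom p q.
by case: (SAB z (sub_zclosure Sz)) => [/(_ _ FAp)|/(_ _ FBq)] ->; rewrite ?mul0r ?mulr0.
Qed.

Definition rel_poly D n (F : nat -> mpoly.mpoly N K) (c : expo D n -> K) :
    mpoly.mpoly N K :=
  \sum_al mpoly.mpolyC N (c al) * mon F al.

Lemma meval_rel_poly D n F (c : expo D n -> K) x :
  mpoly.meval x (rel_poly F c) =
  \sum_al c al * mon (fun i => mpoly.meval x (F i)) al.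
Proof.
rewrite /rel_poly rmorph_sum; apply: eq_bigr => al _.
by rewrite rmorphM/= mpoly.mevalC (rmorph_mon (mpoly.meval x)).
Qed.

(** Algebraic independence of the restrictions to [S] of the first [n] members of [F]. *)
Definition zindep S n (F : nat -> mpoly.mpoly N K) := forall D (c : expo D n -> K),
  (forall x, S x -> \sum_al c al * mon (fun i => mpoly.meval x (F i)) al = 0) ->
  forall al, c al = 0.

Lemma zindep0 S F : S !=set0 -> zindep S 0 F.
Proof.
by move=> [x Sx] D c /(_ x Sx) + []; rewrite (big_pred1 tt)/= ?mulr1// => -[].
Qed.

(** In a relation sum f^j s_j = 0 on [W], once s_i = 0 for all i < j, the factor f^j cancels by
    irreducibility of [W]. Restricting to [Z], where f = 0, leaves s_j = 0 there, and independence
    on [Z] kills the coefficients of s_j. *)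
Lemma zindep_step Z W n F f : Z `<=` W -> zirreducible W ->
  (forall x, Z x -> mpoly.meval x f = 0) ->
  (exists2 x, W x & mpoly.meval x f != 0) ->
  zindep Z n F -> zindep W n.+1 (fun i => if i == n then f else F i).
Proof.
move=> ZW /zirreducible_domain Wdom Zf [x0 Wx0 fx0] Zind D c cW.
pose s (j : 'I_D) := rel_poly F (fun al => c (j, al)).
have sE j x : mpoly.meval x (s j) =
    \sum_(al : expo D n) c (j, al) * mon (fun i => mpoly.meval x (F i)) al.
  exact: meval_rel_poly.
have cE x : W x -> \sum_(j < D) mpoly.meval x f ^+ j * mpoly.meval x (s j) = 0.
  move=> /cW cx; rewrite -[RHS]cx sum_expoS eqxx; apply: eq_bigr => j _; congr (_ * _).
  rewrite sE; apply: eq_bigr => al _; congr (_ * _); apply: eq_mon => i /ltn_eqF.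
  by move=> ->.
suff c0 (j : 'I_D) : forall al, c (j, al) = 0 by case=> j al; apply: c0.
have [k] := ubnP (j : nat); elim: k j => // k IH j; rewrite ltnS => jk.
have s0 (i : 'I_D) : (i < j)%N -> s i = 0.
  move=> ij; rewrite /s /rel_poly big1// => al _.
  by rewrite IH ?(leq_trans ij)// mpoly.mpolyC0 mul0r.
(* The relation divided by [f ^+ j]. *)
pose h : mpoly.mpoly N K := \sum_(i < D | (j <= i)%N) f ^+ (i - j) * s i.
have fh x : W x -> mpoly.meval x (f ^+ j) * mpoly.meval x h = 0.
  move=> Wx; rewrite -[RHS](cE x Wx) -rmorphM/= /h mulr_sumr rmorph_sum/=.
  rewrite [RHS](bigID (fun i : 'I_D => (j <= i)%N))/= [X in _ = _ + X]big1 ?addr0.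
    by apply: eq_bigr => i ji; rewrite mulrA -exprD subnKC// rmorphM/= rmorphXn.
  by move=> i; rewrite -ltnNge => /s0 ->; rewrite mpoly.meval0 mulr0.
have hZ x : Z x -> mpoly.meval x (s j) = 0.
  move=> Zx; have [/(_ _ Wx0)/eqP|/(_ _ (ZW _ Zx)) <-] := Wdom _ _ fh.
    by rewrite rmorphXn/= expf_eq0 (negbTE fx0) andbF.
  rewrite /h [RHS]rmorph_sum/= [RHS](bigD1 j)//= subnn expr0 mul1r big1 ?addr0// => i /andP[ji ij].
  rewrite rmorphM/= rmorphXn/= Zf// expr0n subn_eq0 leqNgt.
  by rewrite ltn_neqAle eq_sym (ij : (i : nat) != j) ji mul0r.
by apply: Zind => x /hZ; rewrite sE.
Qed.

Lemma zchain_indep V k (Z : nat -> set ('I_N -> K)) : zchain V k Z ->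
  forall i, (i <= k)%N -> exists F, zindep (Z i) i F.
Proof.
move=> [Zirr Zlt]; elim=> [|i IH] ik.
  by exists (fun=> 0); apply: zindep0; have [_ []] := Zirr 0%N ik.
have [F Find] := IH (ltnW ik); have [ZZ /existsNP[x /not_implyP[Zx nZx]]] := Zlt i ik.
have [[FZ ZE] _ _] := Zirr i (ltnW ik).
move: nZx; rewrite ZE => /existsNP[f /not_implyP[FZf fx]].
exists (fun j => if j == i then f else F j); apply: zindep_step Find => //.
- by have [] := Zirr i.+1 ik.
- by move=> y; rewrite ZE; apply.
- by exists x => //; apply/eqP.
Qed.

End ZariskiTheory.

(** * Radical towers *)

Lemma growth_sub (K : fieldType) T (G G' : set (T -> K)) n :
  G `<=` G' -> growth G' n -> growth G n.
Proof.
move=> GG' [A GA]; exists A => D; have [I [b [Ib spanb]]] := GA D.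
by exists I, b; split=> // f /(fdeg_mono GG')/spanb.
Qed.

Lemma growth_coords (K : fieldType) T n (x : 'I_n -> T -> K) :
  growth (range x) n.
Proof.
suff xi i : (i <= n)%N -> growth [set g | exists2 a : 'I_n, (a < i)%N & g = x a] i.
  apply: growth_sub (xi n (leqnn n)) => _ [a _ <-]; exists a => //; exact: ltn_ord.
elim: i => [_|i IH ilt].
  by apply: growth_sub (@growth0 _ _) => g [[]].
apply: growth_sub (growth_free (x (Ordinal ilt)) (IH (ltnW ilt))) => _ [a ai ->].
move: ai; rewrite ltnS leq_eqVlt => /orP[/eqP ai|ai]; last by right; exists a.
by left; congr x; apply: val_inj.
Qed.

Section Tower.
Variables (R : realType) (n m : nat) (e : 'I_m -> nat).
Variables (aN aD : forall i : 'I_m, mpoly.mpoly (n + i) (cplx R)).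
Variables (U : set 'rV[cplx R]_n) (delta : 'I_m -> 'rV[cplx R]_n -> cplx R).

Definition radical_tower := [/\ forall i, (0 < e i)%N,
  forall (i : 'I_m) t, U t -> mpoly.meval (tower_pt_lt delta i t) (aD i) != 0 &
  forall (i : 'I_m) t, U t -> delta i t ^+ e i =
     mpoly.meval (tower_pt_lt delta i t) (aN i)
       / mpoly.meval (tower_pt_lt delta i t) (aD i)].

Lemma alg_gen_tower_pt T (tau : T -> 'rV[cplx R]_n) (G : set (T -> cplx R)) :
  (forall a, alg_gen G (fun s => tau s 0 a)) ->
  (forall j, alg_gen G (fun s => delta j (tau s))) ->
  forall p, alg_gen G (fun s => mpoly.meval (tower_pt delta (tau s)) p).
Proof.
move=> Gx Gd p; apply: (alg_gen_meval (v := fun k s => tower_pt delta (tau s) k)) => k.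
by rewrite /tower_pt; case: (fintype.split k).
Qed.

Lemma alg_gen_tower_pt_lt T (tau : T -> 'rV[cplx R]_n) (G : set (T -> cplx R)) (i : 'I_m) :
  (forall a, alg_gen G (fun s => tau s 0 a)) ->
  (forall j : 'I_m, (j < i)%N -> alg_gen G (fun s => delta j (tau s))) ->
  forall p, alg_gen G (fun s => mpoly.meval (tower_pt_lt delta i (tau s)) p).
Proof.
move=> Gx Gd p; apply: (alg_gen_meval (v := fun k s => tower_pt_lt delta i (tau s) k)) => k.
by rewrite /tower_pt_lt; case: (fintype.split k) => // j; apply: Gd => /=.
Qed.

(** The radicals are adjoined one at a time, each without changing the exponent. The map [tau] pulls
    the tower back either to [U], with exponent [n], or to a complex line, with exponent 1. *)
Lemma tower_growth T (tau : T -> 'rV[cplx R]_n) (G0 : set (T -> cplx R)) k :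
  radical_tower -> (forall s, U (tau s)) -> growth G0 k ->
  (forall a, alg_gen G0 (fun s => tau s 0 a)) ->
  exists G, [/\ G0 `<=` G, growth G k &
    forall p, alg_gen G (fun s => mpoly.meval (tower_pt delta (tau s)) p)].
Proof.
move=> [e0 aD0 deltaE] Utau G0k xG0.
pose G i := G0 `|` [set g | exists2 j : 'I_m, (j < i)%N & g = (fun s => delta j (tau s))].
have xG i a : alg_gen (G i) (fun s => tau s 0 a).
  by apply: alg_gen_mono (xG0 a) => g; left.
have dG i (j : 'I_m) : (j < i)%N -> alg_gen (G i) (fun s => delta j (tau s)).
  by move=> ji; apply: alg_gen1; right; exists j.
have Gk i : (i <= m)%N -> growth (G i) k.
  elim: i => [_|i IH im].
    by apply: growth_sub G0k => g [//|[]].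
  pose i' := Ordinal im.
  have aG p : alg_gen (G i) (fun s => mpoly.meval (tower_pt_lt delta i' (tau s)) p).
    by apply: alg_gen_tower_pt_lt => // j; apply: dG.
  apply: growth_sub (growth_alg (IH (ltnW im)) (e0 i') (aG (aN i')) (aG (aD i')) _ _); first last.
  - by move=> s; apply: deltaE.
  - by move=> s; apply: aD0.
  - move=> g [Gg|[j ji ->]]; first by right; left.
    move: ji; rewrite ltnS leq_eqVlt => /orP[/eqP ji|ji]; last by right; right; exists j.
    by left; congr (fun j s => delta j (tau s)); apply: val_inj.
exists (G m); split=> [g||]; [by left|exact: Gk|].
by apply: alg_gen_tower_pt => // j; apply: dG.
Qed.

Lemma tower_dep (F : nat -> mpoly.mpoly (n + m) (cplx R)) : radical_tower ->
  exists D (c : expo D n.+1 -> cplx R), (exists al, c al != 0) /\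
    forall t, U t ->
      \sum_al c al * mon (fun i => mpoly.meval (tower_pt delta t) (F i)) al = 0.
Proof.
(* On the subtype of points of [U] the radical relations hold everywhere. *)
move=> tow; pose x a (s : {t | U t}) := sval s 0 a : cplx R.
have [||G [_ Gn GF]] := @tower_growth _ sval _ n tow _ (growth_coords x).
- by case.
- by move=> a; apply: alg_gen1; exists a.
have [//|D [c [c0 cE]]] :=
  @growth_dep _ _ G n (fun i s => mpoly.meval (tower_pt delta (sval s)) (F i)) Gn _.
by exists D, c; split=> // t Ut; apply: (cE (exist _ t Ut)).
Qed.

Lemma tower_zchain Z : radical_tower -> ~ zchain (tower_variety U delta) n.+1 Z.
Proof.
move=> tow chZ; have [F Find] := zchain_indep chZ (leqnn _).
have [D [c [[al cal] cE]]] := tower_dep F tow.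
apply/negP: cal; apply/negPn/eqP; apply: Find => x Zx.
have [Zirr _] := chZ; have [_ _ ZV] := Zirr n.+1 (leqnn _).
(* Read as a single polynomial, the relation vanishes at the tower points, hence on their closure,
   which contains [Z n.+1]. *)
rewrite -meval_rel_poly; apply: (ZV x Zx) => _ [t Ut <-].
by rewrite meval_rel_poly; apply: cE.
Qed.

End Tower.

(** * The identity theorem on complex lines *)

(** The intersection of [A] and [P] is nonempty, and both open and closed in [A]. *)
Lemma connected_near (T : topologicalType) (A P : set T) : connected A ->
  (forall x, A x -> P x -> \forall y \near x, A y -> P y) ->
  (forall x, A x -> ~ P x -> \forall y \near x, A y -> ~ P y) ->
  A `&` P !=set0 -> A `<=` P.
Proof.
move=> Aconn Popen nPopen AP0; suff <- : A `&` P = A by move=> x [].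
apply: Aconn => //.
- exists (interior [set y | A y -> P y]); first exact: open_interior.
  apply/seteqP; split=> x [Ax Px]; split=> //; first exact: Popen.
  exact: (interior_subset Px).
- exists (~` interior [set y | A y -> ~ P y]).
    by apply: open_closedC; apply: open_interior.
  apply/seteqP; split=> x [Ax Px]; split=> //.
    by move=> /interior_subset /(_ Ax).
  by apply: contrapT => nPx; apply: Px; apply: nPopen.
Qed.

(** If a root r equals z0 + tau (1 + i eps) u with tau and eps real, then v = (r - z0) / u satisfies
    v - conj v = i eps (v + conj v). [B] is the product over the roots of these linear conditions on
    eps; no factor is zero because v is nonzero. *)
Lemma avoid_roots (K : numClosedFieldType) (p : {poly K}) (z0 u : K) :
  p.[z0] != 0 -> u != 0 ->
  exists2 B : {poly K}, B != 0 & forall eps tau, eps \is Num.real -> tau \is Num.real ->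
    B.[eps] != 0 -> p.[z0 + tau * (u + 'i * eps * u)] != 0.
Proof.
move=> pz0 u0; have p0 : p != 0 by apply: contraNneq pz0 => ->; rewrite horner0.
have [rs pE] := closed_field_poly_normal p.
pose v r := (r - z0) / u.
exists (\prod_(r <- rs) ((v r - (v r)^*)%:P - ('i * (v r + (v r)^*)) *: 'X)).
  rewrite prodf_seq_neq0; apply/allP => r rrs /=.
  have vr0 : v r != 0.
    rewrite mulf_neq0 ?invr_eq0// subr_eq0; apply: contraNneq pz0 => <-.
    by rewrite pE -/(root _ _) rootZ ?lead_coef_eq0// root_prod_XsubC.
  apply: contraNneq vr0 => /polyP vr.
  have := vr 0%N; rewrite coef0 coefB coefC coefZ coefX mulr0 subr0 /= => /eqP.
  rewrite subr_eq0 => /eqP v1.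
  have /eqP := vr 1%N; rewrite coef0 coefB coefC coefZ coefX mulr1 sub0r /= oppr_eq0.
  by rewrite mulf_eq0 (negbTE (neq0Ci _))/= -v1 -mulr2n mulrn_eq0.
move=> eps tau epsR tauR; apply: contraNneq => pe.
have : root p (z0 + tau * (u + 'i * eps * u)) by apply/rootP.
rewrite pE rootZ ?lead_coef_eq0// root_prod_XsubC => rrs.
rewrite horner_prod (big_rem _ rrs)/= !hornerE.
have -> : v (z0 + tau * (u + 'i * eps * u)) = tau * (1 + 'i * eps).
  by rewrite /v; field.
rewrite rmorphM rmorphD rmorphM/= conjCi rmorph1 !conj_Creal//.
by apply/eqP; ring.
Qed.

(** * Continuity of polynomial expressions and small points avoiding roots *)

Section FieldTopology.
Variable K : numClosedFieldType.
Local Notation C := (K^o).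

Lemma poly_nonroot_near (q : {poly C}) (P : set C) : q != 0 ->
  (\forall z \near (0 : C), P z) -> exists z : K, [/\ 0 < z, P z & q.[z] != 0].
Proof.
move=> q0 /nbhs_ballP[eta /= eta0 etaP].
(* The first [size q] of these points are distinct, so they cannot all be roots; dividing by at
   least 2 puts them strictly inside the ball. *)
pose z (k : nat) : K := eta / k.+2%:R.
have zP k : 0 < z k /\ P (z k).
  have z0 : 0 < z k by rewrite divr_gt0.
  split=> //; apply: etaP; rewrite -ball_normE /= sub0r normrN gtr0_norm//.
  by rewrite /z gtr_pMr// invf_lt1// ltr1n.
apply: contrapT => nz.
have qz k : root q (z k).
  apply: contraT => qk; exfalso; apply: nz; exists (z k).
  by have [? ?] := zP k; split.
suff : (size [seq z k | k <- iota 0 (size q)] < size q)%N.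
  by rewrite size_map size_iota ltnn.
apply: max_poly_roots => //; first by apply/allP => _ /mapP[k _ ->].
rewrite map_inj_uniq ?iota_uniq// => i j /(mulfI (lt0r_neq0 eta0))/invr_inj/eqP.
by rewrite eqr_nat => /eqP[].
Qed.

Lemma fdeg_continuous (T : topologicalType) (G : set (T -> C)) D f (x : T) :
  (forall g, G g -> {for x, continuous g}) -> fdeg G D f -> {for x, continuous f}.
Proof.
move=> Gc; elim=> {D f} [c|D g f /Gc gc _ fc|D f h _ fc _ hc|//].
- exact: cst_continuous.
- exact: continuousM.
- exact: continuousD.
Qed.

Lemma alg_gen_continuous (T : topologicalType) (G : set (T -> C)) f (x : T) :
  (forall g, G g -> {for x, continuous g}) -> alg_gen G f -> {for x, continuous f}.
Proof. by move=> Gc [D]; apply: fdeg_continuous. Qed.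

Lemma near_neq0 (T : topologicalType) (f : T -> C) (x : T) :
  {for x, continuous f} -> f x != 0 -> \forall y \near x, f y != 0.
Proof.
by move=> fc; apply: (@cvgr_neq0 K C _ _ _ f (f x) fc).
Qed.

End FieldTopology.

Section ComplexSegment.
Variable R : realType.
Local Notation C := (cplx R).

Lemma normc_real_sub (x y : R) : `|x%:C - y%:C|%C = `|x - y|%:C%C :> R[i].
Proof. by rewrite normc_def /= subrr expr0n addr0 sqrtr_sqr. Qed.

Lemma real_complex_near (x : R) (eps : R[i]) : 0 < eps ->
  \forall y \near x, `|x%:C - y%:C|%C < eps.
Proof.
move=> eps0.
have := eps0; rewrite ltcE /= => /andP[/eqP im0 re0].
have epsE : eps = (complex.Re eps)%:C%C by case: (eps) im0 => a b /= ->.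
have xe : \forall y \near x, `|x - y| < complex.Re eps by exact: (nbhsx_ballx x _ re0).
apply: filterS xe => y xy.
by rewrite normc_real_sub epsE ltcR.
Qed.

Lemma real_complex_continuous : continuous (fun x : R => x%:C%C : C).
Proof.
move=> x; apply/cvgrPdist_lt => eps eps0.
exact: (real_complex_near x eps0).
Qed.

(** In the order of [R[i]], lying between 0 and 1 forces a zero imaginary part, so the set is the
    image of a real segment. *)
Lemma complex_segment_connected : connected [set z : C | 0 <= z <= 1].
Proof.
have -> : [set z : C | 0 <= z <= 1] = (fun x : R => x%:C%C : C) @` `[0, 1].
  apply/seteqP; split=> [[a b]|_ [x /= + <-]].
    rewrite /= !lecE /= => /andP[/andP[/eqP -> a0] /andP[_ a1]].
    by exists a; rewrite //= in_itv/= a0.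
  by rewrite in_itv/= => /andP[x0 x1]; rewrite !lecR x0 x1.
apply: connected_continuous_connected; first exact: segment_connected.
apply: continuous_subspaceT; exact: real_complex_continuous.
Qed.

End ComplexSegment.

(** * Zeros of an algebraic function of one variable on a convex open set *)

Section LineZeros.
Variable K : numClosedFieldType.
Local Notation C := (K^o).
Hypothesis segment_conn : connected [set z : C | 0 <= z <= 1].

Lemma affine_continuous (a b : C) : continuous (fun x : C => a + x * b : C).
Proof.
move=> x; apply: (@alg_gen_continuous K C [set id]); first by move=> g -> A.
apply: (@alg_genD _ _ _ (cst a) (fun x => x * b)); first exact: alg_gen_cst.
by apply: (@alg_genM _ _ _ id (cst b)); [apply: alg_gen1|apply: alg_gen_cst].
Qed.

(** A zero of [f] that is not a root of [q k] would propagate along a segment avoiding those roots,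
    up to a point where [f] is nonzero: along it, zeros and nonzeros both form open sets. *)
Lemma line_zeros (Om : set C) (f : C -> C) D k (q : nat -> {poly C}) :
  open Om ->
  (forall z w, Om z -> Om w -> forall s : C, 0 <= s <= 1 -> Om (z + s * (w - z))) ->
  (forall z, Om z -> {for z, continuous f}) ->
  (k < D)%N -> q k != 0 ->
  (forall z, Om z -> \sum_(k <= j < D) (q j).[z] * f z ^+ j = 0) ->
  (exists2 z1, Om z1 & f z1 != 0) ->
  forall z, Om z -> f z = 0 -> (q k).[z] = 0.
Proof.
move=> Om_open Om_conv fc kD qk0 rel [z1 Omz1 fz1] z0 Omz0 fz0.
apply: contrapT => /eqP qz0.
have u0 : z1 - z0 != 0.
  by rewrite subr_eq0; apply: contraNneq fz1 => ->; rewrite fz0.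
have Om_near z : Om z -> \forall w \near z, Om w by move=> Omz; apply: open_nbhs_nbhs.
have local z : Om z -> f z = 0 -> (q k).[z] != 0 -> \forall w \near z, f w = 0.
  (* The relation reads f^k h = 0. At the zero z of f, h equals q_k, so h stays nonzero nearby and
     forces f = 0 there. *)
  move=> Omz fz qz; pose h w : C := \sum_(k <= j < D) (q j).[w] * f w ^+ (j - k).
  have hc : {for z, continuous (h : C -> C)}.
    apply: (@alg_gen_continuous K C [set g | g = id \/ g = f]).
      by move=> g [->|->]; [by move=> A|apply: fc].
    rewrite (_ : h = \sum_(k <= j < D) (fun w : C => (q j).[w] : C) * f ^+ (j - k)); last first.
      apply/funext => w; rewrite /h fct_sumE; apply: eq_bigr => j _.
      by rewrite mulrfctE exprfctE.
    apply: alg_gen_sum => j; apply: alg_genM; last by apply: alg_genX; apply: alg_gen1; right.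
    rewrite (_ : (fun w : C => (q j).[w] : C) =
        \sum_(i < size (q j)) cst (q j)`_i * (id : C -> C) ^+ i); last first.
      apply/funext => w; rewrite horner_coef fct_sumE; apply: eq_bigr => i _.
      by rewrite mulrfctE exprfctE.
    apply: alg_gen_sum => i; apply: alg_genM; first exact: alg_gen_cst.
    by apply: alg_genX; apply: alg_gen1; left.
  have hz : h z = (q k).[z].
    rewrite /h big_ltn// subnn expr0 mulr1 big1_seq ?addr0// => j /=.
    by rewrite mem_index_iota => /andP[kj _]; rewrite fz expr0n subn_eq0 leqNgt kj mulr0.
  have hnz : \forall w \near z, h w != 0 by apply: near_neq0 => //; rewrite hz.
  apply: filterS2 (Om_near z Omz) hnz => w Omw hw.
  have : f w ^+ k * h w = 0.
    rewrite -[RHS](rel w Omw) mulr_sumr; apply: eq_big_nat => j /andP[kj _].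
    by rewrite mulrCA -exprD subnKC.
  by move=> /eqP; rewrite mulf_eq0 (negbTE hw) orbF expf_eq0 => /andP[_ /eqP].
have [B B0 BP] := avoid_roots qz0 u0.
(* The endpoint z1 moves at right angles to the segment, so that z0 + tau (u + i eps u) reaches
   [g eps] at tau = 1. The eps chosen below is positive, hence real as [avoid_roots] requires. *)
pose g (eps : C) : C := z1 + eps * ('i * (z1 - z0)).
have g0 : g 0 = z1 by rewrite /g mul0r addr0.
have near_g : \forall eps \near (0 : C), Om (g eps) /\ f (g eps) != 0.
  apply: (@affine_continuous z1 _ 0 [set w | Om w /\ f w != 0]).
  rewrite -/(g 0) g0; apply: filterI; first exact: Om_near.
  exact: (@near_neq0 K C f z1 (fc _ Omz1) fz1).
have [eps [eps0 [Omg fg] Beps]] := poly_nonroot_near B0 near_g.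
set w := g eps in Omg fg.
pose gam (s : C) : C := z0 + s * (w - z0).
have gamc : continuous gam by apply: affine_continuous.
have Omgam s : 0 <= s <= 1 -> Om (gam s) by move=> s01; apply: Om_conv.
have qgam (s : C) : 0 <= s <= 1 -> (q k).[gam s] != 0.
  move=> /andP[s0 _].
  have := BP eps s (gtr0_real eps0) (ger0_real s0) Beps.
  by congr (_.[_] != 0); rewrite /gam /w /g; ring.
have gam1 : gam 1 = w by rewrite /gam mul1r addrC subrK.
have gam0 : gam 0 = z0 by rewrite /gam mul0r addr0.
suff fw : [set s : C | 0 <= s <= 1] `<=` [set s | f (gam s) = 0].
  have : f (gam 1) = 0 by apply: fw; rewrite /= ler01 lexx.
  by rewrite gam1 => /eqP; apply/negP.
apply: connected_near => //.
- move=> s s01 fs.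
  have near_s : nbhs s (gam @^-1` [set w | f w = 0]) :=
    gamc s _ (local _ (Omgam s s01) fs (qgam s s01)).
  by apply: filterS near_s => s'.
- move=> s s01 /eqP fs.
  have near_s : nbhs s (gam @^-1` [set w | f w != 0]) :=
    gamc s _ (@near_neq0 K C f _ (fc _ (Omgam s s01)) fs).
  by apply: filterS near_s => s' /= /eqP.
- by exists 0 => /=; rewrite lexx ler01 gam0.
Qed.

End LineZeros.

(** * Lines in towers *)

Section Lines.
Variables (K : numClosedFieldType) (V : normedModType K).

Definition line (a b : V) (z : K^o) : V := a + z *: (b - a).

Lemma line0 a b : line a b 0 = a. Proof. by rewrite /line scale0r addr0. Qed.

Lemma line1 a b : line a b 1 = b. Proof. by rewrite /line scale1r addrC subrK. Qed.

Lemma line_continuous a b : continuous (line a b).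
Proof.
move=> z; apply: (@cvgD K V K^o (nbhs z) _ (cst a) (fun y : K^o => y *: (b - a))).
  exact: cvg_cst.
exact: (@scalel_continuous K V (b - a) z).
Qed.

Lemma line_line a b z w s :
  line a b (z + s * (w - z)) = line a b z + s *: (line a b w - line a b z).
Proof.
by rewrite /line opprD addrACA subrr add0r -scalerBl scalerA scalerDl addrA.
Qed.

Lemma ball_convex (c : V) rho a b (s : K) : ball c rho a -> ball c rho b ->
  0 <= s <= 1 -> ball c rho (a + s *: (b - a)).
Proof.
rewrite -ball_normE /ball_ /= => ca cb /andP[s0 s1].
have -> : c - (a + s *: (b - a)) = (1 - s) *: (c - a) + s *: (c - b).
  rewrite scalerBl scale1r -addrA [X in _ = _ + X]addrC -scalerBr opprD addrA -scalerN.
  by congr (_ + s *: _); rewrite !opprB [RHS]addrC addrA subrK.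
apply: le_lt_trans (ler_normD _ _) _; rewrite !normrZ (ger0_norm s0) ger0_norm ?subr_ge0//.
(* For s > 0 strictness comes from the term of b; at s = 0 it comes from a. *)
have [->|sn0] := eqVneq s 0; first by rewrite subr0 mul1r mul0r addr0.
have -> : rho = (1 - s) * rho + s * rho by ring.
apply: ler_ltD; first by rewrite ler_wpM2l ?subr_ge0// ltW.
by rewrite ltr_pM2l// lt0r sn0.
Qed.

Lemma ball_line_convex (c : V) rho a b (z w : K^o) :
  ball c rho (line a b z) -> ball c rho (line a b w) ->
  forall s : K^o, 0 <= s <= 1 -> ball c rho (line a b (z + s * (w - z))).
Proof. by move=> Bz Bw s s01; rewrite line_line; apply: ball_convex. Qed.

Lemma near_line a b (A : set V) : nbhs a A -> \forall z \near (0 : K^o), A (line a b z).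
Proof. by move=> Aa; apply: (@line_continuous a b 0 A); rewrite line0. Qed.

Lemma nbhs_ball_in (c : V) rho a : ball c rho a -> nbhs a (ball c rho).
Proof. by move=> Ba; apply: open_nbhs_nbhs; split=> //; apply: ball_open. Qed.

End Lines.


(** * The identity theorem and irreducibility for towers *)

Section TowerLines.
Variables (R : realType) (n m : nat) (e : 'I_m -> nat).
Local Notation C := (cplx R).
Variables (aN aD : forall i : 'I_m, mpoly.mpoly (n + i) C).
Variables (U : set 'rV[C]_n) (delta : 'I_m -> 'rV[C]_n -> C).
Hypothesis tow : radical_tower e aN aD U delta.
Hypothesis delta_cont : forall i t, U t -> {for t, continuous (delta i)}.
Hypothesis U_open : open U.

Local Notation eval p t := (mpoly.meval (tower_pt delta t) p).

Lemma tower_eval_continuous (p : mpoly.mpoly (n + m) C) t :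
  U t -> {for t, continuous (fun t => eval p t)}.
Proof.
move=> Ut.
pose G := range (fun (a : 'I_n) (t : 'rV[C]_n) => t 0 a) `|` range delta.
apply: (@alg_gen_continuous R[i] _ G).
  move=> _ [[a _ <-]|[i _ <-]]; last exact: delta_cont.
  exact: coord_continuous.
apply: alg_gen_tower_pt => i; apply: alg_gen1; [by left; exists i|by right; exists i].
Qed.

(** Along the line only the parameter z is free, so z and the values of [p] satisfy a relation; [q]
    is its lowest nonzero coefficient in powers of these values. *)
Lemma tower_line_zeros c rho a b z1 (p : mpoly.mpoly (n + m) C) :
  ball c rho `<=` U -> ball c rho (line a b z1) -> eval p (line a b z1) != 0 ->
  exists2 q : {poly C}, q != 0 &
    forall z, ball c rho (line a b z) -> eval p (line a b z) = 0 -> q.[z] = 0.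
Proof.
move=> BU Bz1 pz1.
pose Om : set C := [set z | ball c rho (line a b z)].
pose z_ (s : {z | Om z}) : C := sval s.
have G01 : growth [set z_] 1.
  by apply: growth_sub (growth_free z_ (@growth0 _ _)) => g ->; left.
have [||G [G0G G1 GF]] :=
  @tower_growth R n m e aN aD U delta _ (fun s => line a b (z_ s)) _ 1 tow _ G01.
- by case=> z Omz; apply: BU.
- move=> i.
  rewrite (_ : (fun _ => _) = cst (a 0 i) + z_ * cst ((b - a) 0 i)).
    by apply: alg_genD; [|apply: alg_genM; [apply: alg_gen1|]]; try exact: alg_gen_cst.
  by apply/funext => s; rewrite /line !mxE.
have [|D [k [q [qk0 kD qE]]]] := growth1_dep G1 _ (GF p) (z := z_).
  by apply: alg_gen1; apply: G0G.
exists (q k) => //.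
pose f : C -> C := fun z => eval p (line a b z).
have Om_open : open Om.
  apply: (open_comp (f := line a b)) => [z _|]; first exact: line_continuous.
  exact: ball_open.
have Om_conv : forall z w, Om z -> Om w -> forall s : C, 0 <= s <= 1 -> Om (z + s * (w - z)).
  by move=> z w; apply: (@ball_line_convex R[i] _ c rho a b).
have fc z : Om z -> {for z, continuous f}.
  move=> Omz; have ec := @tower_eval_continuous p _ (BU _ Omz).
  exact: (continuous_comp (@line_continuous R[i] _ a b z) ec).
have rel z : Om z -> \sum_(k <= j < D) (q j).[z] * f z ^+ j = 0.
  by move=> Omz; apply: (qE (exist _ z Omz)).
apply: (@line_zeros R[i] (@complex_segment_connected R) Om f D k q) => //.
by exists z1.
Qed.

(** Inside the ball, the zeros of [p] and of [q] on the line are finite in number, so a point near a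
    avoids both. *)
Lemma tower_line_common c rho a b (p q : mpoly.mpoly (n + m) C) :
  ball c rho `<=` U -> ball c rho a -> ball c rho b ->
  eval p a != 0 -> eval q b != 0 ->
  exists z, [/\ ball c rho (line a b z), eval p (line a b z) != 0 &
    eval q (line a b z) != 0].
Proof.
move=> BU Ba Bb pa qb.
have [||P P0 Pz] := @tower_line_zeros c rho a b 0 p BU; rewrite ?line0//.
have [||Q Q0 Qz] := @tower_line_zeros c rho a b 1 q BU; rewrite ?line1//.
have nearB : \forall z \near (0 : C), ball c rho (line a b z).
  exact: near_line (nbhs_ball_in Ba).
have PQ0 : P * Q != 0 by rewrite mulf_neq0.
have [z [_ Bz]] := poly_nonroot_near PQ0 nearB.
rewrite hornerM mulf_eq0 negb_or => /andP[Pz0 Qz0].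
exists z; split=> //; first by apply: contraNneq Pz0 => /Pz ->.
by apply: contraNneq Qz0 => /Qz ->.
Qed.

Lemma slice_zdomain c rho (S : set 'rV[C]_n) : ball c rho `<=` U ->
  S `<=` ball c rho ->
  (forall a b z, S a -> S b -> ball c rho (line a b z) -> S (line a b z)) ->
  zdomain (tower_pt delta @` S).
Proof.
move=> BU SB Sline p q pq; apply: contrapT => /not_orP[].
move=> /existsNP[_ /not_implyP[[a Sa <-] /eqP pa]].
move=> /existsNP[_ /not_implyP[[b Sb <-] /eqP qb]].
have [z [Bz pz qz]] := tower_line_common BU (SB _ Sa) (SB _ Sb) pa qb.
have /eqP := pq _ (imageP _ (Sline _ _ _ Sa Sb Bz)).
by rewrite mulf_eq0 (negbTE pz) (negbTE qz).
Qed.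

Lemma ball_sub_open t : U t -> exists2 rho : R[i], 0 < rho & ball t rho `<=` U.
Proof. by move=> Ut; apply/nbhs_ballP; apply: open_nbhs_nbhs. Qed.

(** If [p] vanishes near a point a of a ball in [U], the line from a to any b in the ball carries
    infinitely many zeros near a, so [p] vanishes at b. Hence the points near which [p] vanishes
    form a set that is closed as well as open in [U]. *)
Lemma tower_identity (p : mpoly.mpoly (n + m) C) : connected U ->
  (exists2 t, U t & \forall s \near t, eval p s = 0) ->
  forall t, U t -> eval p t = 0.
Proof.
move=> Uconn [t0 Ut0 pt0].
suff UP : U `<=` [set t | \forall s \near t, eval p s = 0].
  by move=> t /UP /nbhs_singleton.
apply: (connected_near Uconn); last by exists t0.
- move=> t Ut /= pt.
  have : nbhs t (interior [set s | eval p s = 0]) by apply: nbhs_interior.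
  by apply: filterS => s ps _.
- move=> t Ut /= npt; have [rho rho0 BU] := ball_sub_open Ut.
  have nearB : \forall s \near t, ball t rho s by apply: nbhsx_ballx.
  apply: filterS nearB => a Ba Ua pa; apply: npt.
  have nearB' : \forall s \near t, ball t rho s by apply: nbhsx_ballx.
  apply: filterS nearB' => b Bb; apply: contrapT => /eqP pb.
  have [||q q0 qz] := @tower_line_zeros t rho a b 1 p BU; rewrite ?line1 => //.
  have nearz : \forall z \near (0 : C), ball t rho (line a b z) /\ eval p (line a b z) = 0.
    apply: (near_line b (A := [set s | ball t rho s /\ eval p s = 0])).
    by apply: filterI => //; apply: nbhs_ball_in.
  have [z [_ [Bz pz]]] := poly_nonroot_near q0 nearz.
  by rewrite (qz _ Bz pz) eqxx.
Qed.

(** Near a point where q is nonzero it stays nonzero, so p vanishes there and the identity theorem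
    spreads this to [U]. *)
Lemma tower_zdomain : connected U -> zdomain (tower_pt delta @` U).
Proof.
move=> Uconn p q pq; have [Uq|] := pselect (forall t, U t -> eval q t = 0).
  by right=> _ [t Ut <-]; apply: Uq.
move=> /existsNP[b /not_implyP[Ub /eqP qb]]; left=> _ [t Ut <-].
apply: tower_identity Ut => //; exists b => //.
have Unear : \forall s \near b, U s by apply: open_nbhs_nbhs.
have qnear : \forall s \near b, eval q s != 0.
  exact: (@near_neq0 R[i] _ _ b (@tower_eval_continuous q b Ub) qb).
apply: filterS2 Unear qnear => s Us qs.
by have /eqP := pq _ (imageP _ Us); rewrite mulf_eq0 (negbTE qs) orbF => /eqP.
Qed.

(** * A chain of length n from slices of a ball *)

Definition slice (c : 'rV[C]_n) rho (k : nat) : set 'rV[C]_n :=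
  [set t | ball c rho t /\ forall j : 'I_n, (k <= j)%N -> t 0 j = c 0 j].

(** The slices grow from the point c at k = 0 to the whole ball at k = n, and the polynomial t_k -
    c_k separates slice k from slice k+1. *)
Lemma slice_zchain c rho : 0 < rho -> ball c rho `<=` U ->
  zchain (tower_variety U delta) n
    (fun k => zariski_closure (tower_pt delta @` slice c rho k)).
Proof.
move=> rho0 BU.
have Bc : ball c rho c by apply: ballxx.
have slice_c k : slice c rho k c by [].
split=> [k kn|k kn].
  split; first exact: zclosed_closure.
    apply: zirreducible_closure; first by exists (tower_pt delta c); apply: imageP.
    apply: (slice_zdomain BU) => [t []//|a b z [Ba ak] [Bb bk] Bz].
    split=> // j kj; rewrite /line !mxE ak// bk// subrr mulr0 addr0 //.
  by apply: zclosure_sub => _ [t [Bt _] <-]; apply: imageP; apply: BU.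
split.
  apply: zclosure_sub => _ [t [Bt tk] <-]; apply: imageP; split=> // j kj.
  by apply: tk; apply: ltnW.
pose i := Ordinal kn.
pose p : mpoly.mpoly (n + m) C :=
  mpoly.mpolyX _ (mpoly.mnm1 (lshift m i)) - mpoly.mpolyC _ (c 0 i).
have pE t : eval p t = t 0 i - c 0 i.
  by rewrite /p mpoly.mevalB mpoly.mevalXU mpoly.mevalC /tower_pt (unsplitK (inl i)).
move=> sub.
pose b : 'rV[C]_n := c + delta_mx 0 i.
have nearB : \forall z \near (0 : C), ball c rho (line c b z).
  exact: near_line (nbhs_ball_in Bc).
(* Only a small positive z is wanted, so the polynomial to avoid is the constant 1. *)
have [z [z0 Bz _]] := poly_nonroot_near (oner_neq0 _) nearB.
have lineE j : line c b z 0 j = c 0 j + z * (j == i)%:R.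
  by rewrite /line (_ : b - c = delta_mx 0 i) ?mxE ?eqxx// /b addrC addKr.
have sz : slice c rho k.+1 (line c b z).
  split=> // j kj; rewrite lineE (_ : j == i = false) ?mulr0 ?addr0//.
  by apply/negbTE; rewrite -val_eqE/= gtn_eqF.
have /(_ p) := sub _ (sub_zclosure (imageP _ sz)).
rewrite pE lineE eqxx mulr1 addrC addKr => z00.
have : z = 0.
  by apply: z00 => _ [t [_ tk] <-]; rewrite pE tk ?subrr.
by move=> zz; rewrite zz ltxx in z0.
Qed.

End TowerLines.

(** * Closure of the projected incidence variety *)

Lemma proj_incidence_closure (R : realType) (n m r : nat)
    (U : set 'rV[cplx R]_n) (delta : 'I_m -> 'rV[cplx R]_n -> cplx R)
    (xN xD : 'I_r -> mpoly.mpoly (n + m) (cplx R)) :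
  tower_variety U delta =
    zariski_closure (proj_star (r := r) @` incidence_variety U delta xN xD).
Proof.
have proj_pt t : proj_star (incidence_pt delta xN xD t) = tower_pt delta t.
  by apply/funext => k; rewrite /proj_star /incidence_pt (unsplitK (inl k)).
apply/seteqP; split.
  apply: zclosure_sub => _ [t Ut <-]; exists (incidence_pt delta xN xD t) => //.
  by apply: sub_zclosure; apply: imageP.
apply: zclosure_min; first exact: zclosed_closure.
move=> _ [y By <-] p pT.
(* The pullback of [p] along the projection; it vanishes at the incidence points, hence on their
   closure. *)
pose lp := mpoly.comp_mpoly
  [tuple mpoly.mpolyX (cplx R) (mpoly.mnm1 (lshift r k)) | k < n + m] p.
have lpE z : mpoly.meval z lp = mpoly.meval (proj_star z) p.
  rewrite mpoly.comp_mpoly_meval; apply: mpoly.meval_eq => k.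
  by rewrite tnth_mktuple mpoly.mevalXU.
rewrite -lpE; apply: By => _ [t Ut <-].
by rewrite lpE proj_pt; apply: pT; apply: imageP.
Qed.

Theorem theorem4p6 (R : realType) (n m r : nat)
    (* radical tower: delta_i ^ e_i = alpha_i = aN_i / aD_i, where aN_i, aD_i
       are polynomials in t, delta_1, ..., delta_{i-1} *)
    (e : 'I_m -> nat)
    (aN aD : forall i : 'I_m, mpoly.mpoly (n + i) (cplx R))
    (* radical parametrization x_j = xN_j(t, delta) / xD_j(t, delta) *)
    (xN xD : 'I_r -> mpoly.mpoly (n + m) (cplx R))
    (* analytic realization of the radicals on a domain U *)
    (U : set 'rV[cplx R]_n) (delta : 'I_m -> 'rV[cplx R]_n -> cplx R) :
  (forall i, (0 < e i)%N) ->
  (n < r)%N ->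
  open U -> connected U -> U !=set0 ->
  (forall (i : 'I_m) (t : 'rV[cplx R]_n), U t -> differentiable (delta i) t) ->
  (forall (i : 'I_m) (t : 'rV[cplx R]_n), U t -> mpoly.meval (tower_pt_lt delta i t) (aD i) != 0) ->
  (forall (i : 'I_m) (t : 'rV[cplx R]_n), U t ->
     delta i t ^+ e i =
       mpoly.meval (tower_pt_lt delta i t) (aN i)
       / mpoly.meval (tower_pt_lt delta i t) (aD i)) ->
  (forall (j : 'I_r) (t : 'rV[cplx R]_n), U t -> mpoly.meval (tower_pt delta t) (xD j) != 0) ->
  (exists2 t, U t & \rank (param_jacobian delta xN xD t) = n) ->
  zirreducible (tower_variety U delta) /\
  zdim_eq (tower_variety U delta) n /\
  tower_variety U delta =
    zariski_closure (proj_star (r := r) @` incidence_variety U delta xN xD).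
Proof.
move=> e0 _ U_open Uconn U0 delta_diff aD0 deltaE _ _.
have tow : radical_tower e aN aD U delta by split.
have delta_cont i t : U t -> {for t, continuous (delta i)}.
  by move=> Ut; apply: differentiable_continuous; apply: delta_diff.
have [c Uc] := U0; have [rho rho0 BU] := ball_sub_open U_open Uc.
split; [|split; [split|]].
- apply: zirreducible_closure; first by exists (tower_pt delta c); apply: imageP.
  exact: (tower_zdomain tow delta_cont U_open Uconn).
- by eexists; apply: (slice_zchain tow delta_cont rho0 BU).
- by move=> Z; apply: (tower_zchain tow).
- exact: proj_incidence_closure.
Qed.
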